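(* Let $K$ be a field and let $G$ be a finite connected simple graph which contains, as an induced subgraph, a path of length $3$ (four vertices and three edges) two of whose vertices are leaves of $G$. Then the ideal $I(G)^2$ is not Cohen--Macaulay.
   Context: For a finite simple graph $G$ with vertex set $V$ and edge set $E(G)$, the edge ideal $I(G)\subseteq S=K[v : v\in V]$ is generated by the monomials $vw$ with $\{v,w\}\in E(G)$. An ideal $J\subseteq S$ is called Cohen--Macaulay if $S/J$ is a Cohen--Macaulay ring. A leaf of $G$ is a vertex belonging to exactly one edge of $G$. *)

(* Defs.v *)
From HB Require Import structures.
From mathcomp Require Import all_boot all_order all_algebra ring_quotient.
From mathcomp Require Import boolp classical_sets.
From mathcomp Require Import mpoly.

Set Implicit Arguments.
Unset Strict Implicit.
Unset Printing Implicit Defensive.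

Import GRing.Theory.
Local Open Scope ring_scope.
Local Open Scope classical_set_scope.

Section Ideals.
Variable R : comNzRingType.
Implicit Types (A I J : set R) (rs : seq R).

Definition ideal_gen A : set R :=
  [set x | exists s : seq (R * R),
     (forall p, p \in s -> A p.2) /\ x = \sum_(p <- s) p.1 * p.2].

Definition ideal_mul I J : set R :=
  ideal_gen [set x | exists a b, [/\ I a, J b & x = a * b]].

(* I ^ 0 is the unit ideal. *)
Definition ideal_exp I k : set R := iter k (ideal_mul I) setT.

(* The structure [idealr R] only contains proper ideals; the unit ideal is
   always finitely generated. *)
Definition noetherian : Prop :=
  forall I : idealr R, exists rs, forall x,
    x \in I <-> ideal_gen [set r | r \in rs] x.

(* Each term is a nonzerodivisor on the quotient of R by the ideal of the
   previous ones, and the quotient by the whole sequence is nonzero. *)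
Definition regular_seq rs : Prop :=
  (forall i, (i < size rs)%N -> forall y,
     ideal_gen [set r | r \in take i rs] (rs`_i * y) ->
     ideal_gen [set r | r \in take i rs] y) /\
  ~ ideal_gen [set r | r \in rs] 1.

Definition is_largest (Q : nat -> Prop) (d : nat) : Prop :=
  Q d /\ forall k, Q k -> (k <= d)%N.

(* depth(I, R), also called the grade of I *)
Definition has_depth (I : idealr R) (d : nat) : Prop :=
  is_largest (fun k => exists rs,
    [/\ size rs = k, {subset rs <= I} & regular_seq rs]) d.

(* The height (codimension) of P, i.e. the Krull dimension of the
   localization of R at P; only P' 0, ..., P' k are relevant. *)
Definition has_height (P : prime_idealr R) (d : nat) : Prop :=
  is_largest (fun k => exists P' : nat -> prime_idealr R,
    (forall i, (i < k)%N ->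
       {subset P' i <= P' i.+1} /\ ~ {subset P' i.+1 <= P' i}) /\
    P' k =i P) d.

Definition maximal_ideal (M : idealr R) : Prop :=
  forall J : idealr R, {subset M <= J} -> {subset J <= M}.

(* Eisenbud, Commutative Algebra, Section 18.2: a noetherian ring is
   Cohen-Macaulay when depth(M, R) = codim M for every maximal ideal M (which
   is in particular prime).  As depth(M, R) is the depth of the local ring R_M
   and codim M its dimension, this says that every R_M is Cohen-Macaulay. *)
Definition cohen_macaulay : Prop :=
  noetherian /\
  forall M : prime_idealr R, maximal_ideal M ->
    exists d, has_depth M d /\ has_height M d.

Lemma ideal_gen0 A : ideal_gen A 0.
Proof. by exists [::]; split => //; rewrite big_nil. Qed.

Lemma ideal_genDM A a x y :
  ideal_gen A x -> ideal_gen A y -> ideal_gen A (a * x + y).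
Proof.
move=> [s [As ->]] [t [At ->]].
exists ([seq (a * p.1, p.2) | p <- s] ++ t); split=> [p|].
  by rewrite mem_cat => /orP[/mapP[q /As Aq ->]|/At].
rewrite big_cat big_map mulr_sumr; congr (_ + _).
by apply: eq_bigr => p _; rewrite mulrA.
Qed.

Lemma ideal_gen_rmorph0 (R' : comNzRingType) (f : {rmorphism R -> R'}) A x :
  (forall y, A y -> f y = 0) -> ideal_gen A x -> f x = 0.
Proof.
move=> fA [s [As ->]]; rewrite rmorph_sum big_seq big1 // => p /As /fA fp.
by rewrite rmorphM fp mulr0.
Qed.

End Ideals.

Arguments noetherian : clear implicits.
Arguments cohen_macaulay : clear implicits.

Definition cohen_macaulay_ideal (R : comNzRingType) (J : idealr R) : Prop :=
  cohen_macaulay {ideal_quot J}.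

Record sgraph := SGraph {
  vertex :> finType;
  adj : rel vertex;
  adj_sym : ssrbool.symmetric adj;
  adj_irrefl : irreflexive adj }.

Section Graphs.
Variable G : sgraph.

Definition edges : {set {set G}} :=
  [set f | [exists u, exists v, adj u v && (f == [set u; v]%SET)]]%SET.

Definition leaf (v : G) : bool := #|[set f in edges | v \in f]%SET| == 1%N.

Definition connected_graph : Prop := forall u v : G, connect (@adj G) u v.

(* p 0, p 1, p 2, p 3 are distinct, and the edges of G among them are exactly
   those joining consecutive vertices. *)
Definition induced_path4 (p : 'I_4 -> G) : Prop :=
  injective p /\
  forall i j : 'I_4,
    ([set p i; p j]%SET \in edges) = (i.+1 == j :> nat) || (j.+1 == i :> nat).

End Graphs.

Section EdgeIdeal.
Variables (K : fieldType) (G : sgraph).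

(* K[v : v in V], the vertices being numbered by [enum_rank] *)
Local Notation S := {mpoly K[#|G|]}.

Definition vertex_var (v : G) : S := 'X_(enum_rank v).

Definition edge_ideal : set S :=
  ideal_gen [set m | exists v w : G,
    [set v; w]%SET \in edges G /\ m = vertex_var v * vertex_var w].

Definition edge_ideal_sq : pred S :=
  fun f => `[< ideal_exp edge_ideal 2 f >].

Lemma edge_ideal_sq_closed : idealr_closed edge_ideal_sq.
Proof.
split=> [||a x y /asboolP Ix /asboolP Iy].
- by apply/asboolP; exact: ideal_gen0.
- apply/asboolP => I1.
  pose ev : {rmorphism S -> K} := meval (fun=> 0).
  suff /eqP : ev 1 = 0 by rewrite rmorph1 oner_eq0.
  apply: ideal_gen_rmorph0 I1 => _ [a [b [Ia _ ->]]].
  suff eva : ev a = 0 by rewrite rmorphM eva mul0r.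
  apply: ideal_gen_rmorph0 Ia => _ [v [w [_ ->]]].
  by rewrite rmorphM /= mevalXU mul0r.
- by apply/asboolP; apply: ideal_genDM.
Qed.

HB.instance Definition _ := isIdealr.Build S edge_ideal_sq
  edge_ideal_sq_closed.

End EdgeIdeal.

Arguments edge_ideal : clear implicits.
Arguments edge_ideal_sq : clear implicits.

(* Main.v *)
Require Import Defs.
From HB Require Import structures.
From mathcomp Require Import all_boot all_order all_algebra ring_quotient.
From mathcomp Require Import boolp classical_sets.
From mathcomp Require Import mpoly.
From mathcomp Require Import zify ring.

(* Let x - y - z - w be the path, with leaves x and w, and let F be a maximal
   independent set among the vertices adjacent to neither y nor z.  Write u for
   the monomial y z prod(F).  For a vertex v outside F put a_v = v u when v is
   adjacent to z but not to y, and a_v = 0 otherwise.  Then v a_v' - v' a_v lies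
   in I(G)^2 for all v, v', so (a_v) is a Koszul 1-cocycle of S / I(G)^2 on the
   variables outside F; it is not a coboundary because neither x u nor w u is in
   I(G)^2.  Adding the |F| remaining variables one at a time, a grading argument
   gives a nonzero class in degree at most |F| + 1 of the Koszul cohomology on
   all variables, which bounds the depth at the irrelevant maximal ideal by
   |F| + 1.  But F together with y and w is independent, so that ideal has
   height at least |F| + 2. *)

Set Implicit Arguments.
Unset Strict Implicit.
Unset Printing Implicit Defensive.

Import GRing.Theory.

(** * Koszul cochains and their differential, coefficients being read modulo an ideal *)

Section Koszul.
Local Open Scope ring_scope.
Variable R : comNzRingType.
Implicit Types (xs cs fs : seq R) (J : R -> Prop).

(* A cochain [(a, b)] on [x :: xs] stands for the form [a + dx /\ b]. *)
Fixpoint koszul xs : lmodType R :=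
  if xs is _ :: xs' then (koszul xs' * koszul xs')%type else R^o.

Fixpoint kdiff xs : koszul xs -> koszul xs :=
  match xs with
  | [::] => fun _ => 0
  | x :: xs' => fun p => (kdiff p.1, x *: p.1 - kdiff p.2)
  end.

(* Degrees are shifted by one: [kdeg n] is the space of forms of degree
   [n - 1], so that [kdeg 0] is zero. *)
Fixpoint kdeg xs (n : nat) : koszul xs -> Prop :=
  match xs with
  | [::] => fun a => n <> 1%N -> a = 0
  | x :: xs' => fun p => kdeg n p.1 /\ kdeg n.-1 p.2
  end.

Fixpoint kin J xs : koszul xs -> Prop :=
  match xs with
  | [::] => J
  | x :: xs' => fun p => kin J p.1 /\ kin J p.2
  end.

Fixpoint kmap (g : R -> R) xs : koszul xs -> koszul xs :=
  match xs with
  | [::] => g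
  | x :: xs' => fun p => (kmap g p.1, kmap g p.2)
  end.

(** Coefficients beyond the end of [cs] count as 0, so [exists cs, f = dot cs xs] expresses
    membership of [f] in the ideal of [xs] with no condition on lengths. *)
Fixpoint dot cs xs : R :=
  if xs is x :: xs' then head 0 cs * x + dot (behead cs) xs' else 0.

(* Interior product with the vector field of components [cs]. *)
Fixpoint kcontr cs xs : koszul xs -> koszul xs :=
  match xs with
  | [::] => fun _ => 0
  | x :: xs' => fun p =>
      (head 0 cs *: p.2 + kcontr (behead cs) p.1, - kcontr (behead cs) p.2)
  end.

(** Unlike [idealr], this admits the unit ideal, so [ideal_add1] preserves it unconditionally. *)
Definition ideal J := J 0 /\ forall a x y, J x -> J y -> J (a * x + y).

(* The cohomology of [R / J] in (unshifted) degree [n - 1] vanishes. *)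
Definition koszul_exact n xs J := forall a : koszul xs,
  kdeg n a -> kin J (kdiff a) -> exists2 b, kdeg n.-1 b & kin J (a - kdiff b).

Definition ideal_add1 J f : R -> Prop := fun y => exists c, J (y - c * f).

(** The nonzerodivisor half of [regular_seq]; the elements already used are absorbed into [J], which
    suits induction on the sequence. *)
Fixpoint regular_on J fs : Prop :=
  if fs is f :: fs' then
    (forall y, J (f * y) -> J y) /\ regular_on (ideal_add1 J f) fs'
  else True.

Lemma dot_nil xs : dot [::] xs = 0.
Proof. by elim: xs => //= x xs ->; rewrite mul0r addr0. Qed.

Lemma dot_lin a cs cs' xs :
  exists cs'', dot cs'' xs = a * dot cs xs + dot cs' xs.
Proof.
elim: xs cs cs' => [|x xs IH] cs cs' /=; first by exists [::]; ring.
have [cs'' E] := IH (behead cs) (behead cs').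
by exists (a * head 0 cs + head 0 cs' :: cs'') => /=; rewrite E; ring.
Qed.

Lemma dot_mem x xs : x \in xs -> exists cs, x = dot cs xs.
Proof.
elim: xs => // y xs IH; rewrite inE => /predU1P[->|/IH[cs E]].
  by exists [:: 1]; rewrite /= dot_nil mul1r addr0.
by exists (0 :: cs); rewrite /= mul0r add0r.
Qed.

Lemma kdiff_is_linear xs : linear (@kdiff xs).
Proof.
elim: xs => [|x xs IH] k a b /=; first by rewrite scaler0 addr0.
case: a b => [a1 a2] [b1 b2] /=; rewrite !IH; congr pair => /=.
rewrite scalerBr !scalerDr !scalerA mulrC opprD.
by rewrite addrACA.
Qed.

HB.instance Definition _ xs :=
  GRing.isLinear.Build R (koszul xs) (koszul xs) _ (@kdiff xs)
    (@kdiff_is_linear xs).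

Lemma kcontr_is_linear cs xs : linear (@kcontr cs xs).
Proof.
elim: xs cs => [|x xs IH] cs k a b /=; first by rewrite scaler0 addr0.
case: a b => [a1 a2] [b1 b2] /=; rewrite !IH; congr pair => /=.
  by rewrite !scalerDr !scalerA mulrC addrACA.
by rewrite opprD scalerN.
Qed.

HB.instance Definition _ cs xs :=
  GRing.isLinear.Build R (koszul xs) (koszul xs) _ (@kcontr cs xs)
    (@kcontr_is_linear cs xs).

Lemma kdiffK xs (a : koszul xs) : kdiff (kdiff a) = 0.
Proof.
elim: xs a => [//|x xs IH] [a b] /=.
by rewrite linearB linearZ /= !IH subr0 subrr.
Qed.

(** Cartan's formula: the differential is exterior multiplication by the form with components [xs],
    and contraction is an antiderivation. Hence every element of the ideal of [xs] is
    null-homotopic. *)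
Lemma kcontr_homotopy cs xs (a : koszul xs) :
  kdiff (kcontr cs a) + kcontr cs (kdiff a) = dot cs xs *: a.
Proof.
elim: xs cs a => [|x xs IH] cs a /=; first by rewrite addr0 scale0r.
case: a => a b; congr pair => /=.
  rewrite linearD linearZ /= scalerBr scalerDl scalerA -IH.
  by rewrite addrACA subrKC.
rewrite linearB linearZ linearN /= scalerDl -IH scalerDr scalerA opprK opprB.
by rewrite [x * _]mulrC -!addrA; congr (_ + _); rewrite addrCA subrKC.
Qed.

Lemma kdeg_lin xs n r (a b : koszul xs) :
  kdeg n a -> kdeg n b -> kdeg n (r *: a + b).
Proof.
elim: xs n a b => [|x xs IH] n a b /=.
  by move=> a0 b0 nn; rewrite a0 // b0 // scaler0 addr0.
by case: a b => [a1 a2] [b1 b2] /= [? ?] [? ?]; split; apply: IH.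
Qed.

Lemma kdeg0 xs n : kdeg n (0 : koszul xs).
Proof. by elim: xs n => //= x xs IH n; split. Qed.

Lemma kdeg0_eq xs (a : koszul xs) : kdeg 0 a -> a = 0.
Proof.
by elim: xs a => [|x xs IH] a /=; [apply|case: a => a b /= [/IH -> /IH ->]].
Qed.

Lemma kdegD xs n (a b : koszul xs) : kdeg n a -> kdeg n b -> kdeg n (a + b).
Proof. by move=> da; rewrite -[a]scale1r; apply: kdeg_lin. Qed.

Lemma kdegZ xs n r (a : koszul xs) : kdeg n a -> kdeg n (r *: a).
Proof.
by move=> da; rewrite -[r *: a]addr0; apply: kdeg_lin => //; apply: kdeg0.
Qed.

Lemma kdegB xs n (a b : koszul xs) : kdeg n a -> kdeg n b -> kdeg n (a - b).
Proof. by move=> da db; rewrite -scaleN1r addrC; apply: kdeg_lin. Qed.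

Lemma kdeg_contr cs xs n (a : koszul xs) :
  kdeg n a -> kdeg n.-1 (kcontr cs a).
Proof.
elim: xs cs n a => [|x xs IH] cs n a //=; case: a => a b /= [da db].
split; first by apply: kdeg_lin => //; apply: IH.
by rewrite -scaleN1r; apply/kdegZ/IH.
Qed.

Lemma kdeg_diff xs n (a : koszul xs) : kdeg n a -> kdeg n.+1 (kdiff a).
Proof.
elim: xs n a => [|x xs IH] n a //=; case: a => a b /= [da db].
split; first exact: IH.
apply: kdegB; first exact: kdegZ.
case: n da db => [|n] da db /=; last exact: IH.
by rewrite (kdeg0_eq db) linear0; apply: kdeg0.
Qed.

Lemma kdeg_map g xs n (a : koszul xs) :
  g 0 = 0 -> kdeg n a -> kdeg n (kmap g a).
Proof.
move=> g0; elim: xs n a => [|x xs IH] n a /=; first by move=> a0 /a0 ->.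
by case: a => a b /= [da db]; split; apply: IH.
Qed.

Section Ideal.
Variable J : R -> Prop.
Hypothesis idJ : ideal J.

Lemma ideal_add1P f : ideal (ideal_add1 J f).
Proof.
case: idJ => J0 JD; split; first by exists 0; rewrite mul0r subr0.
move=> a x y [c Jc] [c' Jc']; exists (a * c + c').
by have := JD a _ _ Jc Jc'; congr J; ring.
Qed.

Lemma kin0 xs : kin J (0 : koszul xs).
Proof. by elim: xs => [|x xs IH] /=; [case: idJ|split]. Qed.

Lemma kin_lin xs r (a b : koszul xs) :
  kin J a -> kin J b -> kin J (r *: a + b).
Proof.
elim: xs a b => [|x xs IH] a b /=; first by apply: (idJ.2 r).
by case: a b => [a1 a2] [b1 b2] /= [? ?] [? ?]; split; apply: IH.
Qed.

Lemma kinZ xs r (a : koszul xs) : kin J a -> kin J (r *: a).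
Proof.
by move=> Ja; rewrite -[r *: a]addr0; apply: kin_lin => //; apply: kin0.
Qed.

Lemma kinD xs (a b : koszul xs) : kin J a -> kin J b -> kin J (a + b).
Proof. by move=> Ja Jb; rewrite -[a]scale1r; apply: kin_lin. Qed.

Lemma kinB xs (a b : koszul xs) : kin J a -> kin J b -> kin J (a - b).
Proof. by move=> Ja Jb; rewrite -scaleN1r addrC; apply: kin_lin. Qed.

Lemma kin_diff xs (a : koszul xs) : kin J a -> kin J (kdiff a).
Proof.
elim: xs a => [|x xs IH] a /=; first by case: idJ.
case: a => a b /= [Ja Jb]; split; first exact: IH.
by apply: kinB; [apply: kinZ|apply: IH].
Qed.

Lemma kin_contr cs xs (a : koszul xs) : kin J a -> kin J (kcontr cs a).
Proof.
elim: xs cs a => [|x xs IH] cs a /=; first by case: idJ.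
case: a => a b /= [Ja Jb]; split; first by apply: kin_lin => //; apply: IH.
by rewrite -scaleN1r; apply/kinZ/IH.
Qed.

Lemma kin_map g xs (a : koszul xs) :
  (forall x, J x -> J (g x)) -> kin J a -> kin J (kmap g a).
Proof.
by move=> gJ; elim: xs a => [|x xs IH] a //=; first exact: gJ;
  case: a => a b /= [Ja Jb]; split; apply: IH.
Qed.

Lemma kin_add1 f n xs (a : koszul xs) : kdeg n a -> kin (ideal_add1 J f) a ->
  exists2 c, kdeg n c & kin J (a - f *: c).
Proof.
elim: xs n a => [|x xs IH] n a /=.
  case: (n =P 1%N) => [-> _ [c Jc]|nn a0 _].
    by exists c => //; rewrite /GRing.scale /= mulrC.
  by exists 0 => //; rewrite scaler0 subr0 a0 //; case: idJ.
case: a => a b /= [da db] [/(IH _ _ da)[c dc Jc] /(IH _ _ db)[e de Je]].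
by exists (c, e).
Qed.

Lemma kin_regular f xs (a : koszul xs) :
  (forall y, J (f * y) -> J y) -> kin J (f *: a) -> kin J a.
Proof.
move=> fJ; elim: xs a => [|x xs IH] a /=; first exact: fJ.
by case: a => a b /= [/IH ? /IH ?].
Qed.

End Ideal.

(** * Vanishing of cohomology below the length of a regular sequence *)

Lemma koszul_exact0 xs J : ideal J -> koszul_exact 0 xs J.
Proof.
move=> idJ a /kdeg0_eq -> _; exists 0; first exact: kdeg0.
by rewrite linear0 subr0; apply: kin0.
Qed.

(* Rees: multiplication by [f] in the ideal of [xs] is zero on cohomology, so
   if [f] is regular every class is a connecting image of a class of one
   degree less over the quotient by [f]. *)
Lemma regular_koszul_exact xs fs J n : ideal J ->
  (forall f, f \in fs -> exists cs, f = dot cs xs) ->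
  regular_on J fs -> (n <= size fs)%N -> koszul_exact n xs J.
Proof.
elim: fs J n => [|f fs IH] J [|n] // idJ fsx;
  try by move=> *; apply: koszul_exact0.
move=> [fJ regfs] nfs a da Jda /=.
have [cs fE] := fsx f (mem_head _ _).
have := kcontr_homotopy cs a; rewrite -fE.
set b := kcontr cs a => faE.
have db : kdeg n b by apply: kdeg_contr da.
have Jab : kin J (f *: a - kdiff b).
  by rewrite -faE addrC addKr; apply: kin_contr.
have idJf := ideal_add1P idJ f.
have subJ y : J y -> ideal_add1 J f y by exists 0; rewrite mul0r subr0.
have kinS ys (e : koszul ys) : kin J e -> kin (ideal_add1 J f) e.
  by elim: ys e => [|y ys IHy] //= [e e'] /= [? ?]; split; apply: IHy.
have Jdb : kin (ideal_add1 J f) (kdiff b).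
  have -> : kdiff b = f *: a - (f *: a - kdiff b) by rewrite subKr.
  apply: kinB => //; last exact: kinS.
  elim: (xs) (a) => [|y ys IHy] e /=; last first.
    by split; apply: IHy.
  exists (e : R).
  by rewrite /GRing.scale /= mulrC subrr; case: idJ.
have fsx' g : g \in fs -> exists cs, g = dot cs xs.
  by move=> gfs; apply: fsx; rewrite in_cons gfs orbT.
(* [b] is a cocycle modulo [J] and [f], so by induction it equals a coboundary plus [f *: c] modulo
   [J]. This [c] is the primitive of [a]: modulo [J], f (a - dc) is d (b - db' - f c), hence zero,
   and [f] cancels. *)
have [b' db' Jbb'] := IH _ n idJf fsx' regfs nfs b db Jdb.
have dbb' : kdeg n (b - kdiff b').
  apply: kdegB => //; case: (n) db db' => [|m] _ /= db'; last exact: kdeg_diff.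
  by rewrite (kdeg0_eq db') linear0; apply: kdeg0.
have [c dc Jc] := kin_add1 idJ dbb' Jbb'.
exists c => //; apply: (kin_regular fJ); rewrite scalerBr.
have -> : f *: a - f *: kdiff c
    = (f *: a - kdiff b) + kdiff (b - kdiff b' - f *: c).
  rewrite [kdiff (_ - _ - _)]linearB /= [kdiff (b - _)]linearB /= kdiffK subr0.
  by rewrite [kdiff (_ *: _)]linearZ /= addrA addrNK.
by apply: kinD => //; apply: kin_diff.
Qed.

(** The form dt /\ a is a cocycle on [t :: xs]; a primitive a' + dt /\ b of it exhibits [a] as
    [t *: a'] up to a coboundary. So [t] acts surjectively on the cohomology of [xs]. *)
Lemma koszul_exact_cons_surj n t xs J : ideal J ->
  koszul_exact n.+1 (t :: xs) J ->
  forall a : koszul xs, kdeg n a -> kin J (kdiff a) ->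
  exists a' b, [/\ kdeg n a', kin J (kdiff a'), kdeg n.-1 b &
                   kin J (a - t *: a' - kdiff b)].
Proof.
move=> idJ H a da Jda; have [||[a' b] /= [da' db'] [Ja' Jb']] := H (0, a).
- by split=> //=; apply: kdeg0.
- split=> /=; first by rewrite linear0; apply: kin0.
  by rewrite scaler0 sub0r -scaleN1r; apply: kinZ.
exists a', (- b); split => //.
- by rewrite sub0r -scaleN1r in Ja'; have := kinZ idJ (-1) Ja';
    rewrite scalerA mulrNN mulr1 scale1r.
- by rewrite -scaleN1r; apply: kdegZ.
by rewrite linearN opprK; move: Jb'; rewrite opprB addrCA addrC.
Qed.

Lemma kmapZ g x xs (a : koszul xs) : (forall b, g (x * b) = x * g b) ->
  kmap g (x *: a) = x *: kmap g a.
Proof.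
move=> gx; elim: xs a => [|y ys IH] a /=; first exact: gx.
by case: a => a b /=; congr pair; apply: IH.
Qed.

Lemma kmapB g xs : (forall a b, g (a - b) = g a - g b) ->
  {morph @kmap g xs : u v / u - v}.
Proof.
move=> gB; elim: xs => [|x xs IH] u v /=; first exact: gB.
by case: u v => [u1 u2] [v1 v2] /=; congr pair; apply: IH.
Qed.

Lemma kdiff_map g xs (a : koszul xs) : g 0 = 0 ->
  (forall a b, g (a - b) = g a - g b) ->
  {in xs, forall x b, g (x * b) = x * g b} ->
  kdiff (kmap g a) = kmap g (kdiff a).
Proof.
move=> g0 gB; elim: xs a => [|x xs IH] /= a gM; first by rewrite g0.
have gxs : {in xs, forall x b, g (x * b) = x * g b}.
  by move=> y yxs; apply: gM; rewrite inE yxs orbT.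
case: a => a b /=; rewrite !IH //; congr pair.
rewrite kmapB //; congr (_ - _).
by rewrite kmapZ // => c; apply: gM; apply: mem_head.
Qed.

(** * Removing a variable [t], with [g n] the projection onto degree [n] in [t] *)

Section Graded.
Variables (J : R -> Prop) (t : R) (xs : seq R) (g : nat -> R -> R).
Hypothesis idJ : ideal J.
Hypothesis gB : forall n a b, g n (a - b) = g n a - g n b.
Hypothesis gM : forall n, {in xs, forall x a, g n (x * a) = x * g n a}.
Hypothesis gJ : forall n a, J a -> J (g n a).
Hypothesis gt0 : forall a, g 0 (t * a) = 0.
Hypothesis gtS : forall n a, g n.+1 (t * a) = t * g n a.
Hypothesis gsum : forall a, exists N, forall M, (N <= M)%N ->
  \sum_(m < M) g m a = a.

Let g0 n : g n 0 = 0. Proof. by rewrite -[X in g n X](subrr 0) gB subrr. Qed.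

(** Up to a coboundary [a] is [t *: a'] for a cocycle [a']. Its component of degree 0 is therefore a
    coboundary, and that of degree m + 1 is [t] times the component of degree m of [a'], to which
    the induction applies. *)
Lemma kmap_component_exact n (a : koszul xs) m :
  koszul_exact n.+1 (t :: xs) J -> kdeg n a -> kin J (kdiff a) ->
  exists2 b, kdeg n.-1 b & kin J (kmap (g m) a - kdiff b).
Proof.
move=> H; elim: m a => [|m IH] a da Jda;
  have [a' [b [da' Jda' db Jab]]] := koszul_exact_cons_surj idJ H da Jda.
- exists (kmap (g 0) b); first exact: kdeg_map.
  have := kin_map (gJ 0) Jab; rewrite !kmapB // -kdiff_map //.
  suff -> : kmap (g 0) (t *: a') = 0 by rewrite subr0.
  elim: (xs) (a') => [|y ys IHy] u /=; first exact: gt0.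
  by case: u => u v; congr pair; apply: IHy.
have [b' db' Jb'] := IH _ da' Jda'.
exists (t *: b' + kmap (g m.+1) b).
  by apply: kdeg_lin => //; apply: kdeg_map.
have := kin_map (gJ m.+1) Jab; rewrite !kmapB // -kdiff_map //.
have -> : kmap (g m.+1) (t *: a') = t *: kmap (g m) a'.
  elim: (xs) (a') => [|y ys IHy] u /=; first exact: gtS.
  by case: u => u v; congr pair; apply: IHy.
move=> Jab'; have := kin_lin idJ t Jb' Jab'; congr (kin J _).
rewrite linearP /= scalerBr opprD addrC -!addrA; congr (_ + _).
by rewrite addrCA addKr addrC.
Qed.

(* [t] acts surjectively on the cohomology of [xs], which is graded by the
   nonnegative degree in [t], and hence vanishes. *)
Lemma koszul_exact_cons n :
  koszul_exact n.+1 (t :: xs) J -> koszul_exact n xs J.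
Proof.
move=> H a da Jda.
pose S M y := \sum_(m < M) g m y.
have SE M : exists2 b, kdeg n.-1 b & kin J (kmap (S M) a - kdiff b).
  elim: M => [|M [b db Jb]].
    exists 0; first exact: kdeg0.
    rewrite linear0 subr0; apply: (@eq_ind _ 0 _ (kin0 idJ xs)).
    elim: (xs) (a) => [|y ys IHy] u /=; first by rewrite /S big_ord0.
    by case: u => u v; congr pair; apply: IHy.
  have [c dc Jc] := kmap_component_exact M H da Jda.
  exists (b + c); first exact: kdegD.
  have := kinD idJ Jb Jc; rewrite addrACA -opprD -linearD.
  suff -> : kmap (S M.+1) a = kmap (S M) a + kmap (g M) a by [].
  elim: (xs) (a) => [|y ys IHy] u /=; first by rewrite /S big_ord_recr.
  by case: u => u v; congr pair; apply: IHy.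
(* A cochain has finitely many coefficients, so one bound from [gsum] serves them all. *)
suff [N] : exists N, forall M, (N <= M)%N -> kmap (S M) a = a.
  by move/(_ N (leqnn N)) => aE; have := SE N; rewrite aE.
elim: (xs) (a) => [|y ys IHy] u /=; first exact: gsum.
case: u => u v /=; have [N uE] := IHy u; have [N' vE] := IHy v.
by exists (maxn N N') => M; rewrite geq_max => /andP[/uE -> /vE ->].
Qed.

End Graded.

(** * Exactness at 1-forms, stated for families of coefficients *)

Section DegreeOne.
Variables (I : eqType) (X : I -> R).
Implicit Types (s : seq I) (f : I -> R).

Fixpoint kcst xs r : koszul xs :=
  match xs with
  | [::] => r
  | x :: xs' => (kcst xs' r, 0)
  end.

(** The 1-form with coefficient [f i] on the differential of [X i]; [kcst] gives the 0-forms. *)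
Fixpoint kone f s : koszul [seq X i | i <- s] :=
  match s with
  | [::] => 0
  | i :: s' => (kone f s', kcst [seq X j | j <- s'] (f i))
  end.

Lemma kdeg_cst xs r : kdeg 1 (kcst xs r).
Proof. by elim: xs => //= x xs IH; split=> //; apply: kdeg0. Qed.

Lemma kdeg_one f s : kdeg 2 (kone f s).
Proof. by elim: s => //= x s IH; split=> //; apply: kdeg_cst. Qed.

Lemma kdeg1_cst xs (a : koszul xs) : kdeg 1 a -> exists r, a = kcst xs r.
Proof.
elim: xs a => [|x xs IH] a /=; first by exists a.
by case: a => a b /= [/IH[r ->] /kdeg0_eq ->]; exists r.
Qed.

Lemma kin_cst J xs r : ideal J -> kin J (kcst xs r) <-> J r.
Proof.
move=> idJ; elim: xs => //= x xs IH; split=> [[/IH]//|/IH ?].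
by split=> //; apply: kin0.
Qed.

Lemma kin_one J f s : ideal J ->
  kin J (kone f s) <-> {in s, forall i, J (f i)}.
Proof.
move=> idJ; elim: s => [|i s IH] /=; first by split=> // _; case: idJ.
split=> [[/IH Js /kin_cst Ji] j|Js].
  by rewrite inE => /predU1P[->|/Js//]; apply: Ji.
split; last by apply/kin_cst/Js/mem_head.
by apply/IH => j js; apply: Js; rewrite inE js orbT.
Qed.

Lemma kcstB xs r a b : kcst xs (r * a - b) = r *: kcst xs a - kcst xs b.
Proof.
by elim: xs => [//|x xs /= ->]; congr pair; rewrite /= scaler0 subr0.
Qed.

Lemma kcst0 xs : kcst xs 0 = 0.
Proof. by elim: xs => [//|x xs /= ->]. Qed.

Lemma koneB r f h s :
  kone (fun i => r * f i - h i) s = r *: kone f s - kone h s.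
Proof.
elim: s => [|i s /= ->] /=; first by rewrite scaler0 subr0.
by congr pair; apply: kcstB.
Qed.

Lemma kdiff_cst r s :
  kdiff (kcst [seq X i | i <- s] r) = kone (fun i => X i * r) s.
Proof.
elim: s => [//|i s /= ->]; congr pair; rewrite linear0 subr0.
by rewrite -[X i * r]subr0 kcstB kcst0 subr0.
Qed.

(** The coefficients of the differential of [kone f s] are the [X i * f j - X j * f i], and a
    primitive is a 0-form [r], whose differential has coefficients [X i * r]. *)
Lemma koszul_exact_family J s f : ideal J ->
  koszul_exact 2 [seq X i | i <- s] J ->
  {in s &, forall i j, J (X i * f j - X j * f i)} ->
  exists r, {in s, forall i, J (f i - X i * r)}.
Proof.
move=> idJ H Jf; have [||b /kdeg1_cst[r ->]] := H (kone f s).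
- exact: kdeg_one.
- elim: s Jf {H} => [|i s IH] Jf /=; first by case: idJ.
  split.
    by apply: IH => j k js ks; apply: Jf; rewrite inE ?js ?ks orbT.
  rewrite kdiff_cst -koneB; apply/kin_one => // j js.
  by apply: Jf; rewrite inE ?eqxx ?js ?orbT.
rewrite kdiff_cst -[kone f s]scale1r -koneB => /(kin_one _ _ idJ) Jr.
by exists r => i /Jr; rewrite mul1r.
Qed.

End DegreeOne.

End Koszul.

(** * Prime ideals and regular sequences of a quotient ring, seen from the ring above *)

Section Quotients.
Local Open Scope ring_scope.
Local Open Scope quotient_scope.
Variables (R : comNzRingType) (J : idealr R).
Local Notation Q := {ideal_quot J}.

Lemma pi_quot_eq0 (y : R) : (\pi_Q y == 0) = (y \in J).
Proof. by rewrite -[0](rmorph0 \pi_Q) -Quotient.idealrBE subr0. Qed.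

Section KernelIdeal.
Variables (D : idomainType) (phi : {rmorphism R -> D}).

(** The kernel of the map induced by [phi] on the quotient, prime because [D] is a domain. Carrying
    [phiJ] as an argument lets the prime ideal structure attach to the predicate. *)
Definition quot_ker (phiJ : {in J, forall y, phi y = 0}) : pred Q :=
  fun r => phi (repr r) == 0.

Hypothesis phiJ : {in J, forall y, phi y = 0}.

Lemma quot_ker_pi y : (\pi_Q y \in quot_ker phiJ) = (phi y == 0).
Proof.
rewrite unfold_in; congr (_ == 0); apply/eqP; rewrite -subr_eq0 -rmorphB.
by rewrite phiJ // Quotient.idealrBE reprK.
Qed.

Lemma quot_ker_idealr : idealr_closed (quot_ker phiJ).
Proof.
split=> [||r]; first by rewrite -(rmorph0 \pi_Q) quot_ker_pi rmorph0.
  by rewrite -(rmorph1 \pi_Q) quot_ker_pi rmorph1 oner_eq0.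
move=> u v; rewrite -[r]reprK -[u]reprK -[v]reprK.
rewrite -rmorphM -rmorphD !quot_ker_pi rmorphD rmorphM.
by move=> /eqP-> /eqP->; rewrite mulr0 addr0.
Qed.

Lemma quot_ker_prime : prime_idealr_closed (quot_ker phiJ).
Proof.
move=> u v; rewrite -[u]reprK -[v]reprK -rmorphM !quot_ker_pi rmorphM.
by rewrite mulf_eq0.
Qed.

HB.instance Definition _ := isIdealr.Build Q (quot_ker phiJ) quot_ker_idealr.
HB.instance Definition _ :=
  isPrimeIdealrClosed.Build Q (quot_ker phiJ) quot_ker_prime.

End KernelIdeal.

Lemma ideal_gen_rcons (T : comNzRingType) (s : seq T) r z :
  ideal_gen [set x | x \in rcons s r]%classic z <->
  exists c, ideal_gen [set x | x \in s]%classic (z - c * r).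
Proof.
split=> [[t [ts ->]]|[c [t [ts E]]]].
  elim: t ts => [|[a b] t IH] ts.
    by exists 0; rewrite big_nil mul0r subr0; apply: ideal_gen0.
  have [|c gc] := IH; first by move=> p pt; apply: ts; rewrite inE pt orbT.
  have /= := ts (a, b) (mem_head _ _); rewrite mem_rcons inE big_cons /=.
  case/predU1P=> [->|bs].
    by exists (a + c); rewrite mulrDl opprD addrACA subrr add0r.
  exists c; rewrite -addrA; apply: ideal_genDM => //.
  exists [:: (1, b)]; split; last by rewrite big_seq1 mul1r.
  by move=> p; rewrite inE => /eqP ->.
exists ((c, r) :: t); split; last by rewrite big_cons -E /= addrC subrK.
move=> p; rewrite inE => /predU1P[-> /=|/ts /=].
  by rewrite mem_rcons mem_head.
by rewrite mem_rcons inE => ->; rewrite orbT.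
Qed.

Lemma regular_seq_on (rs : seq Q) : regular_seq rs ->
  regular_on (fun y => y \in J) [seq repr r | r <- rs].
Proof.
move=> [reg _].
(* Generalize to a prefix [rs0] already divided out, with [J] replaced by the preimage of the ideal
   that [rs0] generates. *)
suff main rs0 rs1 : rs = rs0 ++ rs1 ->
    regular_on (fun y => ideal_gen [set r | r \in rs0]%classic (\pi_Q y))
      [seq repr r | r <- rs1].
  have := main [::] rs erefl; congr regular_on.
  apply/funext => y; apply/propext; rewrite -pi_quot_eq0.
  split=> [[s [s0 ->]]|/eqP ->]; last exact: ideal_gen0.
  by case: s s0 => [|p s /(_ p (mem_head _ _))//]; rewrite big_nil eqxx.
elim: rs1 rs0 => [//|r rs1 IH] rs0 E /=; split.
  move=> y; rewrite rmorphM /= reprK.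
  have := reg (size rs0); rewrite E size_cat /=.
  rewrite -[X in (X < _)%N]addn0 ltn_add2l.
  by rewrite take_size_cat // nth_cat ltnn subnn; apply.
have := IH (rcons rs0 r); rewrite cat_rcons => /(_ E); congr regular_on.
apply/funext => y; apply/propext; rewrite /ideal_add1; split.
  move/ideal_gen_rcons => [c gc]; exists (repr c).
  by rewrite rmorphB rmorphM /= !reprK.
move=> [c gc]; apply/ideal_gen_rcons; exists (\pi_Q c).
by move: gc; rewrite rmorphB rmorphM /= reprK.
Qed.

End Quotients.

(** * Monomial ideals, gradings by one variable, and killing variables *)

Section Monomial.
Local Open Scope ring_scope.
Variables (n : nat) (K : fieldType).
Local Notation S := {mpoly K[n]}.
Local Notation mnm := 'X_{1..n}.
Implicit Types (f g : S) (m u : mnm) (U : mnm -> Prop).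

Definition upset U := forall m m', U m -> (m <= m')%MM -> U m'.

(** For an upset [U] this is the monomial ideal spanned by the monomials with exponent in [U]. *)
Definition mono_in U f := forall m, f@_m != 0 -> U m.

Lemma mcoeffXM u f m :
  ('X_[u] * f)@_m = if (u <= m)%MM then f@_(m - u) else 0.
Proof.
rewrite mulrC; case: ifP => [um|/negP um]; first by 
  by have := mcoeffMX f u (m - u)%MM; rewrite addmC submK.
apply/eqP; rewrite mcoeff_eq0; apply/negP => /msuppM_le /allpairsP[[m1 m2]] /=.
rewrite msuppX inE => -[_ /eqP -> E]; apply: um; rewrite E.
exact: lem_addl.
Qed.

Lemma mono_in_ideal U : upset U -> ideal (mono_in U).
Proof.
move=> upU; split=> [m|a f g fU gU m]; first by rewrite mcoeff0 eqxx.
rewrite mcoeffD; case: (eqVneq (g@_m) 0) => [->|/gU //]; rewrite addr0.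
rewrite -mcoeff_msupp => /msuppM_le /allpairsP[[m1 m2]] /= [_].
by rewrite mcoeff_msupp => /fU Um ->; apply: upU Um _; apply: lem_addl.
Qed.

Lemma mono_in_gen U (A : set S) : upset U ->
  (forall f, A f -> mono_in U f) -> forall f, ideal_gen A f -> mono_in U f.
Proof.
move=> /mono_in_ideal [U0 UD] AU f [s [sA ->]].
elim: s sA => [|p s IH] sA; first by rewrite big_nil.
rewrite big_cons; apply: UD; first exact/AU/sA/mem_head.
by apply: IH => q qs; apply: sA; rewrite inE qs orbT.
Qed.

Lemma mono_in_mul U1 U2 f g : mono_in U1 f -> mono_in U2 g ->
  mono_in (fun m => exists m1 m2, [/\ U1 m1, U2 m2 & m = (m1 + m2)%MM]) (f * g).
Proof.
move=> fU gU m; rewrite -mcoeff_msupp => /msuppM_le /allpairsP[[m1 m2]] /=.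
by rewrite !mcoeff_msupp => -[/fU ? /gU ? ->]; exists m1, m2.
Qed.

(** The component of degree [k] in the variable [i], which instantiates [g] above. *)
Definition mcomp (i : 'I_n) (k : nat) f : S :=
  \sum_(m <- msupp f | m i == k) f@_m *: 'X_[m].

Lemma mcoeff_mcomp i k f m :
  (mcomp i k f)@_m = if m i == k then f@_m else 0.
Proof.
rewrite raddf_sum /=; have [mf|mf] := boolP (m \in msupp f); last first.
  rewrite (memN_msupp_eq0 mf) if_same big_seq_cond big1 // => m' /andP[m'f _].
  rewrite mcoeffZ mcoeffX; case: eqP => [E|_]; last by rewrite mulr0.
  by rewrite E (negbTE mf) in m'f.
rewrite big_mkcond (bigD1_seq m) //= ?msupp_uniq // big1 ?addr0.
  by rewrite mcoeffZ mcoeffX eqxx mulr1.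
by move=> m' /negbTE nm; case: ifP => // _; rewrite mcoeffZ mcoeffX nm mulr0.
Qed.

Lemma mcompB i k f g : mcomp i k (f - g) = mcomp i k f - mcomp i k g.
Proof.
apply/mpolyP => m; rewrite mcoeffB !mcoeff_mcomp mcoeffB.
by case: ifP; rewrite ?subr0.
Qed.

Lemma mcompMX_neq i j k f : i != j -> mcomp i k ('X_j * f) = 'X_j * mcomp i k f.
Proof.
move=> ij; apply/mpolyP => m; rewrite mcoeff_mcomp !mcoeffXM mcoeff_mcomp.
rewrite mnmBE mnm1E eq_sym in ij *; rewrite (negbTE ij) subn0.
by case: ifP; case: ifP.
Qed.

Lemma mcompMX0 i f : mcomp i 0 ('X_i * f) = 0.
Proof.
apply/mpolyP => m; rewrite mcoeff_mcomp !mcoeffXM mcoeff0 lep1mP.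
by case: (m i).
Qed.

Lemma mcompMXS i k f : mcomp i k.+1 ('X_i * f) = 'X_i * mcomp i k f.
Proof.
apply/mpolyP => m; rewrite mcoeff_mcomp !mcoeffXM mcoeff_mcomp lep1mP.
rewrite mnmBE mnm1E eqxx; case: (m i) => [|j] //=.
by rewrite subSS subn0 eqSS.
Qed.

Lemma mcomp_sum i f : exists N, forall M, (N <= M)%N ->
  \sum_(k < M) mcomp i k f = f.
Proof.
(* [msize f] exceeds the total degree, hence every exponent, of each monomial of [f]. *)
exists (msize f) => M fM; apply/mpolyP => m; rewrite raddf_sum /=.
under eq_bigr do rewrite mcoeff_mcomp.
have [mf|/memN_msupp_eq0 ->] := boolP (m \in msupp f); last first.
  by rewrite big1 // => k _; rewrite if_same.
have mi : (m i < M)%N.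
  apply: leq_trans fM; apply: leq_ltn_trans (msize_mdeg_lt mf).
  by rewrite mdegE (bigD1 i) //= leq_addr.
rewrite (bigD1 (Ordinal mi)) //= eqxx big1 ?addr0 // => k.
by rewrite -val_eqE eq_sym => /negbTE /= ->.
Qed.

Lemma mono_in_mcomp U i k f : mono_in U f -> mono_in U (mcomp i k f).
Proof.
by move=> fU m; rewrite mcoeff_mcomp; case: ifP => _; [apply: fU|rewrite eqxx].
Qed.

Lemma mnm_neq0 m : m != 0%MM -> exists i, m i != 0%N.
Proof.
have [i mi|m0] := pickP (fun i => m i != 0%N); first by exists i.
case/eqP; apply/mnmP => i; rewrite mnm0E.
by apply/eqP; rewrite -[_ == _]negbK m0.
Qed.

(** Every monomial of [f] is divisible by some variable. This supplies the membership that
    [regular_koszul_exact] asks of a sequence in the irrelevant ideal. *)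
Lemma dot_vars (s : seq 'I_n) f : (forall i, i \in s) -> f@_0 = 0 ->
  exists cs, f = dot cs [seq 'X_i | i <- s].
Proof.
move=> s_all f0; rewrite [f]mpolyE big_seq.
elim/big_ind: _ => [|_ _ [cs ->] [cs' ->]|m].
- by exists [::]; rewrite dot_nil.
- have [cs'' E] := dot_lin 1 cs cs' [seq 'X_i | i <- s].
  by exists cs''; rewrite E mul1r.
rewrite mcoeff_msupp => fm.
have [i mi] : exists i, m i != 0%N.
  by apply: mnm_neq0; apply: contraNneq fm => ->; rewrite f0.
have [cs E] := dot_mem (map_f (fun i => 'X_i : S) (s_all i)).
have [cs' E'] := dot_lin (f@_m *: 'X_[m - U_(i)]) cs [::] [seq 'X_i | i <- s].
exists cs'; rewrite E' -E dot_nil addr0 -scalerAl -mpolyXD submK //.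
by rewrite lep1mP.
Qed.

(** Each variable dropped costs one degree. Distinctness makes multiplication by the other variables
    commute with [mcomp t]. *)
Lemma koszul_exact_drop_vars U (ts s : seq 'I_n) k :
  upset U -> uniq (ts ++ s) ->
  koszul_exact (size ts + k) [seq 'X_i | i <- ts ++ s] (mono_in U) ->
  koszul_exact k [seq ('X_i : S) | i <- s] (mono_in U).
Proof.
move=> upU; elim: ts => //= t ts IH /andP[tN us] H; apply: (IH us).
apply: (koszul_exact_cons (t := 'X_t) (g := mcomp t)) H => //.
- exact: mono_in_ideal.
- exact: mcompB.
- move=> j x /mapP[i is_ ->] a; apply: mcompMX_neq.
  by apply: contraNneq tN => ->.
- by move=> j a; apply: mono_in_mcomp.
- exact: mcompMX0.
- by move=> j a; apply: mcompMXS.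
exact: mcomp_sum.
Qed.

Definition zero_vars (W : {set 'I_n}) : S -> S :=
  comp_mpoly [tuple if i \in W then 0 else 'X_i | i < n].

HB.instance Definition _ W := GRing.RMorphism.on (zero_vars W).

Lemma zero_varsX W i : zero_vars W 'X_i = if i \in W then 0 else 'X_i.
Proof. by rewrite /zero_vars comp_mpolyXU -tnth_nth tnth_mktuple. Qed.

Lemma zero_varsXm W m :
  zero_vars W 'X_[m] = if [forall i in W, m i == 0%N] then 'X_[m] else 0.
Proof.
rewrite /zero_vars comp_mpolyX; case: ifP => [/forall_inP m0|/negbT].
  rewrite [RHS]mpolyXE_id; apply: eq_bigr => i _; rewrite tnth_mktuple.
  by case: ifP => // /m0/eqP ->; rewrite !expr0.
case/forall_inPn => i iW mi; rewrite (bigD1 i) //= tnth_mktuple iW.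
by rewrite expr0n (negbTE mi) mul0r.
Qed.

Lemma mcoeff_zero_vars W f m :
  (zero_vars W f)@_m = if [forall i in W, m i == 0%N] then f@_m else 0.
Proof.
rewrite [in LHS](mpolyE f) (raddf_sum (zero_vars W)) raddf_sum /=.
have E m' : (zero_vars W (f@_m' *: 'X_[m']))@_m =
    if [forall i in W, m i == 0%N] then (f@_m' *: 'X_[m'])@_m else 0.
  rewrite -mul_mpolyC rmorphM /= zero_varsXm {1}/zero_vars comp_mpolyC.
  rewrite !mul_mpolyC !mcoeffZ; case: (eqVneq m' m) => [->|ne].
    by case: ifP; rewrite ?mcoeff0 ?mulr0.
  have E0 : ('X_[m'] : S)@_m = 0 by rewrite mcoeffX (negbTE ne).
  by do 2 case: ifP => _; rewrite ?mcoeff0 ?E0 ?mulr0.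
under eq_bigr do rewrite E.
case: ifP => _; last by rewrite big1.
by rewrite [in RHS](mpolyE f) raddf_sum.
Qed.

(** Substitution fixes the monomials free of [W] and kills the others, so its kernel is the ideal
    generated by the variables in [W]. *)
Lemma zero_vars_eq0 W f :
  zero_vars W f = 0 <-> mono_in (fun m => exists2 i, i \in W & m i != 0%N) f.
Proof.
split=> [E m fm|fW].
  have /mpolyP/(_ m) := E; rewrite mcoeff_zero_vars mcoeff0.
  case: ifP => [_ /eqP|/negbT /forall_inPn[i]]; first by rewrite (negbTE fm).
  by exists i.
apply/mpolyP => m; rewrite mcoeff_zero_vars mcoeff0.
case: ifP => // /forall_inP mW.
by apply/eqP; apply: contraT => /fW[i /mW ->].
Qed.

End Monomial.

(** * The square of the edge ideal: primes from independent sets, and Koszul vanishing *)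

Section EdgeIdealSquare.
Local Open Scope ring_scope.
Local Open Scope quotient_scope.
Variables (K : fieldType) (G : sgraph).
Local Notation S := {mpoly K[#|G|]}.
Local Notation mnm := 'X_{1..#|G|}.
Local Notation U v := (U_(enum_rank v))%MM.
Local Notation J := (edge_ideal_sq K G).
Local Notation Q := {ideal_quot (J : idealr S)}.
Implicit Types (u v w : G) (F : {set G}).

Lemma edges_pair u v : ([set u; v]%SET \in edges G) = adj u v.
Proof.
apply/idP/idP => [|uv]; last first.
  by rewrite inE; apply/existsP; exists u; apply/existsP; exists v;
    rewrite uv /=.
rewrite inE => /existsP[u' /existsP[v' /andP[uv' /eqP E]]].
have := set21 u v; have := set22 u v; rewrite E !inE.
have := set21 u' v'; have := set22 u' v'; rewrite -E !inE.
have irr x := adj_irrefl x.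
have neq : u' <> v' by move=> E'; rewrite E' irr in uv'.
move=> /orP[]/eqP v'E /orP[]/eqP u'E /orP[]/eqP vE /orP[]/eqP uE; subst => //.
all: by rewrite // adj_sym.
Qed.

Definition edge_dvd (m : mnm) :=
  exists u v, adj u v /\ (U u + U v <= m)%MM.

Definition edge_sq_dvd (m : mnm) :=
  exists u v u' v', [/\ adj u v, adj u' v' &
    (U u + U v + (U u' + U v') <= m)%MM].

Lemma edge_sq_dvd_upset : upset edge_sq_dvd.
Proof.
move=> m m' [u [v [u' [v' [uv uv' le]]]]] lem.
by exists u, v, u', v'; split=> //; apply: lepm_trans lem.
Qed.

Lemma mem_edge_ideal_sq (f : S) : f \in J <-> mono_in edge_sq_dvd f.
Proof.
split=> [/asboolP|fU].
  apply: mono_in_gen; first exact: edge_sq_dvd_upset.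
  have up1 : upset edge_dvd.
    by move=> m m' [u [v [uv le]]] lem; exists u, v; split=> //;
      apply: lepm_trans lem.
  have I1 a : edge_ideal K G a -> mono_in edge_dvd a.
    apply: mono_in_gen => // _ [u [v [uv ->]]] m.
    rewrite -mpolyXD mcoeffX; case: (_ =P m) => [<- _|_]; last by rewrite eqxx.
    by exists u, v; rewrite -edges_pair; split; last exact: lepm_refl.
  move=> _ [a [b [/I1 Ia Ib ->]]].
  (* [ideal_exp] ends in the unit ideal, so [b] is only known to lie in the product of I(G) with the
     whole ring. *)
  have {}Ib : mono_in edge_dvd b.
    apply: mono_in_gen Ib => // _ [c [d [/I1 Ic _ ->]]].
    have [I0 ID] := mono_in_ideal K up1.
    by rewrite mulrC -[d * c]addr0; apply: ID.
  move=> m /(mono_in_mul Ia Ib)[m1 [m2 [[u [v [uv le1]]]]]].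
  move=> [u' [v' [uv' le2]]] ->.
  exists u, v, u', v'; split=> //; apply/mnm_lepP => i.
  rewrite [leqRHS]mnmDE [leqLHS]mnmDE.
  exact: leq_add (elimT mnm_lepP le1 i) (elimT mnm_lepP le2 i).
rewrite [f]mpolyE; apply: rpred_sum => m _.
have [->|/fU] := eqVneq (f@_m) 0; first by rewrite scale0r rpred0.
case=> u [v [u' [v' [uv uv' le]]]].
rewrite -(submK le) mpolyXD scalerAl; apply: idealMr; apply/asboolP.
have e1 a b : adj a b -> edge_ideal K G (vertex_var K a * vertex_var K b).
  move=> ab; exists [:: (1, vertex_var K a * vertex_var K b)].
  split; last by rewrite big_seq1 mul1r.
  by move=> p; rewrite inE => /eqP ->; exists a, b; rewrite edges_pair.
exists [:: (1, 'X_[U u + U v + (U u' + U v')])]; split; last first.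
  by rewrite big_seq1 mul1r.
move=> p; rewrite inE => /eqP -> /=; rewrite !mpolyXD.
exists ('X_[U u] * 'X_[U v]), ('X_[U u'] * 'X_[U v']); split=> //.
  exact: e1.
exists [:: (1, 'X_[U u'] * 'X_[U v'])]; split; last by rewrite big_seq1 mul1r.
move=> q; rewrite inE => /eqP -> /=.
by exists ('X_[U u'] * 'X_[U v']), 1; split; rewrite ?mulr1 //; apply: e1.
Qed.

Definition independent F := {in F &, forall u v, ~~ adj u v}.

Section FaceChain.
Variable F : {set G}.
Hypothesis indepF : independent F.

(** The chain of primes starts with the variables outside [F] and adds those of [F] one by one,
    reaching the irrelevant ideal at k = [#|F|]. *)
Definition killed k : {set 'I_#|G|} :=
  [set i | (enum_val i \notin F) || (enum_val i \in take k (enum F))]%SET.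

(** By independence every edge has an endpoint outside [F], whose variable is killed. *)
Lemma killed_ideal k : {in J, forall f, zero_vars (killed k) f = 0 :> S}.
Proof.
move=> f /mem_edge_ideal_sq fU; apply/zero_vars_eq0 => m /fU.
case=> u [v [u' [v' [uv _ /mnm_lepP le]]]].
have [uF|uF] := boolP (u \in F); last first.
  exists (enum_rank u); first by rewrite inE enum_rankK uF.
  rewrite -lt0n; apply: leq_trans (le _).
  by rewrite !mnmDE !mnm1E eqxx !addn_gt0 /= ?orbT.
exists (enum_rank v); last first.
  rewrite -lt0n; apply: leq_trans (le _).
  by rewrite !mnmDE !mnm1E eqxx !addn_gt0 /= ?orbT.
by rewrite inE enum_rankK; apply/orP; left; apply: contraTN uv => /(indepF uF).
Qed.

Definition face_prime k : prime_idealr Q :=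
  quot_ker (@killed_ideal k).

Lemma mem_face_prime k (f : S) :
  (\pi_Q f \in face_prime k) = (zero_vars (killed k) f == 0).
Proof. exact: quot_ker_pi. Qed.

Lemma mem_face_prime_top (f : S) :
  (\pi_Q f \in face_prime #|F|) = (f@_0 == 0).
Proof.
rewrite mem_face_prime; apply/eqP/eqP => [/zero_vars_eq0 fW|f0].
  by apply/eqP; apply: contraT => /fW[i _]; rewrite mnm0E.
apply/zero_vars_eq0 => m fm.
have [i mi] : exists i, m i != 0%N.
  by apply: mnm_neq0; apply: contraNneq fm => ->; rewrite f0.
exists i => //; rewrite inE cardE take_size mem_enum orbC.
exact: orbN.
Qed.

Lemma face_prime_maximal : maximal_ideal (face_prime #|F|).
Proof.
move=> I sub r rI; rewrite -[r]reprK mem_face_prime_top.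
set f := repr r; apply/negPn/negP => f0.
suff : 1 \in I by rewrite idealr1.
have fI : \pi_Q f \in I by rewrite /f reprK.
(* [f] minus its constant term lies in the irrelevant ideal, so [I] would contain a unit. *)
have cI : \pi_Q (f@_0)%:MP \in I.
  rewrite -[X in \pi_Q X](subKr f) rmorphB rpredB //; apply: sub.
  by rewrite mem_face_prime_top mcoeffB mcoeffC eqxx mulr1 subrr.
have := idealMr (\pi_Q ((f@_0)^-1)%:MP) cI.
by rewrite -rmorphM -mpolyCM mulVf // mpolyC1 rmorph1.
Qed.

Lemma face_prime_height d : has_height (face_prime #|F|) d -> (#|F| <= d)%N.
Proof.
case=> _; apply; exists face_prime; split => // k kF.
have kE : (k < size (enum F))%N by rewrite -cardE.
have [v0 _] : exists v, v \in F by apply/card_gt0P; apply: leq_trans kF.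
have memF : nth v0 (enum F) k \in F by rewrite -mem_enum mem_nth.
split=> [r|sub].
  have [f ->] : exists f, r = \pi_Q f by exists (repr r); rewrite reprK.
  move=> fk; rewrite mem_face_prime in fk; rewrite mem_face_prime.
  move/eqP/zero_vars_eq0: fk => f0; apply/eqP/zero_vars_eq0 => m /f0[i iW mi].
  exists i => //; move: iW; rewrite !inE => /orP[->//|].
  by rewrite (take_nth v0) // mem_rcons inE => ->; rewrite !orbT.
(* The vertex at index [k] of [enum F] witnesses that the inclusion is strict. *)
have vk1 : \pi_Q (vertex_var K (nth v0 (enum F) k)) \in face_prime k.+1.
  rewrite mem_face_prime zero_varsX !inE enum_rankK.
  by rewrite (take_nth v0) // mem_rcons mem_head orbT.
have {vk1 sub} := sub _ vk1.
rewrite mem_face_prime zero_varsX !inE enum_rankK memF.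
rewrite in_take ?mem_nth // index_uniq ?enum_uniq // ltnn.
by rewrite /= -msupp_eq0 msuppX.
Qed.

(** At the irrelevant ideal the depth equals the height, which is at least [#|F|]; a regular
    sequence of that depth then forces the vanishing. *)
Lemma cohen_macaulay_koszul_exact (s : seq 'I_#|G|) :
  cohen_macaulay_ideal J -> (forall i, i \in s) ->
  forall k, (k <= #|F|)%N ->
  koszul_exact k [seq ('X_i : S) | i <- s] (mono_in edge_sq_dvd).
Proof.
move=> [_ cm] s_all k kF; have [d [dep hgt]] := cm _ face_prime_maximal.
have leFd := face_prime_height hgt.
have [[rs [szrs rsM /regular_seq_on reg]] _] := dep.
have -> : mono_in edge_sq_dvd = (fun f => f \in J).
  apply/funext => f; apply/propext; exact: iff_sym (mem_edge_ideal_sq f).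
apply: regular_koszul_exact reg _; last by rewrite size_map szrs (leq_trans kF).
- split=> [|a x y]; first exact: rpred0.
  by move=> Jx Jy; rewrite rpredD // idealMr.
move=> _ /mapP[r rrs ->]; apply: dot_vars => //; apply/eqP.
by rewrite -mem_face_prime_top reprK; apply: rsM.
Qed.

End FaceChain.
End EdgeIdealSquare.

(** * The path with leaves at both ends, and its nonzero Koszul class *)

Section Whiskers.
Local Open Scope ring_scope.
Variables (K : fieldType) (G : sgraph).
Local Notation S := {mpoly K[#|G|]}.
Local Notation mnm := 'X_{1..#|G|}.
Local Notation U v := (U_(enum_rank v))%MM.
Local Notation J := (edge_ideal_sq K G).
Implicit Types (x y z w u v : G) (F : {set G}).

Lemma leaf_adj_uniq u v v' : leaf u -> adj u v -> adj u v' -> v = v'.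
Proof.
move=> /cards1P[e Ee] uv uv'.
have ine t : adj u t -> [set u; t]%SET = e.
  move=> ut; apply/set1P; rewrite -Ee inE edges_pair ut /=.
  exact: set21.
have : v \in [set u; v']%SET by rewrite ine // -(ine v) // set22.
by rewrite !inE => /orP[]/eqP // vu; rewrite vu adj_irrefl in uv.
Qed.

Definition set_mnm F : mnm := (\sum_(f in F) U f)%MM.

Lemma set_mnmE F v : set_mnm F (enum_rank v) = (v \in F).
Proof.
rewrite /set_mnm mnm_sumE; have [vF|vF] := boolP (v \in F).
  rewrite (bigD1 v) //= mnm1E eqxx big1 // => f /andP[_ fv].
  by rewrite mnm1E (inj_eq enum_rank_inj) (negbTE fv).
rewrite big1 // => f fF; rewrite mnm1E (inj_eq enum_rank_inj).
by case: eqP => // fv; rewrite -fv fF in vF.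
Qed.

(* Every edge supported on the given monomial contains [y], which occurs in it
   only to the first power. *)
Lemma leaf_not_edge_sq_dvd x y z F :
  adj y z -> (forall v, adj x v -> v = y) -> independent F ->
  {in F, forall f, ~~ adj f y && ~~ adj f z} -> adj x y -> x != z ->
  ~ edge_sq_dvd (U x + (U y + U z + set_mnm F))%MM.
Proof.
move=> yz x_leaf indF Fyz xy xz [a [b [a' [b' [ab ab' /mnm_lepP le]]]]].
have mE v : (U x + (U y + U z + set_mnm F))%MM (enum_rank v)
    = ((x == v) + ((y == v) + (z == v) + (v \in F)))%N.
  by rewrite !mnmDE set_mnmE !mnm1E !(inj_eq enum_rank_inj).
have supp v : (0 < (U x + (U y + U z + set_mnm F))%MM (enum_rank v))%N ->
    [|| v == x, v == y, v == z | v \in F].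
  rewrite mE ![v == _]eq_sym.
  by case: (x == v); case: (y == v); case: (z == v); case: (v \in F).
have edge_y u v : adj u v -> [|| u == x, u == y, u == z | u \in F] ->
    [|| v == x, v == y, v == z | v \in F] -> (u == y) || (v == y).
  move=> uv /or4P[/eqP E|->//|/eqP E|uF].
  - by rewrite E in uv; rewrite (x_leaf v uv) eqxx orbT.
  - subst u => /or4P[/eqP E|->|/eqP E|/Fyz/andP[_]]; rewrite ?orbT //.
    + by rewrite E adj_sym in uv; rewrite (x_leaf _ uv) eqxx.
    + by rewrite E adj_irrefl in uv.
    by rewrite adj_sym uv.
  case/or4P => [/eqP E|->|/eqP E|vF]; rewrite ?orbT //.
  - by rewrite E adj_sym in uv; rewrite (x_leaf _ uv) eqxx.
  - by have := Fyz _ uF; rewrite -E uv andbF.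
  by have := indF _ _ uF vF; rewrite uv.
have le' v := le (enum_rank v).
have aE u v : (U u) (enum_rank v) = (u == v) :> nat.
  by rewrite mnm1E (inj_eq enum_rank_inj).
have ay : (a == y) || (b == y).
  apply: edge_y => //; apply: supp; apply: leq_trans (le' _);
    by rewrite !mnmDE !aE eqxx; case: eqP.
have by' : (a' == y) || (b' == y).
  apply: edge_y => //; apply: supp; apply: leq_trans (le' _);
    by rewrite !mnmDE !aE eqxx !addn_gt0 /= ?orbT.
have yF : y \notin F.
  by apply/negP => /Fyz/andP[_]; rewrite yz.
have zy : z != y by apply/eqP => E; rewrite E adj_irrefl in yz.
have xy' : x != y by apply/eqP => E; rewrite E adj_irrefl in xy.
have := le' y; rewrite mE !mnmDE !aE (negbTE yF) (negbTE zy) (negbTE xy') eqxx.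
move: ay by'.
have pos (c d : bool) : c || d -> (0 < c + d)%N by case: c; case: d.
move=> /pos ay /pos by'.
by rewrite leqNgt (leq_add ay by').
Qed.

Lemma whiskers_not_cohen_macaulay x y z w :
  adj x y -> adj y z -> adj z w -> y != w -> x != z ->
  (forall v, adj x v -> v = y) -> (forall v, adj w v -> v = z) ->
  ~ cohen_macaulay_ideal J.
Proof.
move=> xy yz zw yw xz x_leaf w_leaf cm.
pose P F := [forall u in F, forall v in F, ~~ adj u v] &&
            [forall u in F, ~~ adj u y && ~~ adj u z].
have P0 : P finset.set0.
  by apply/andP; split; apply/forall_inP => u; rewrite finset.inE.
have [F0 /maxsetP[/andP[/forall_inP indF /forall_inP Fyz] Fmax] _] :=
  maxset_exists P0.
have ind0 : independent F0.
  by move=> u v uF vF; have /forall_inP := indF u uF; apply.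
(* By maximality: without such a neighbour, [v |: F0] would still satisfy [P]. *)
have dom v : v \notin F0 -> ~~ adj v y -> ~~ adj v z ->
    exists2 f, f \in F0 & adj v f.
  move=> vF vy vz; apply/exists_inP; apply: contraNT vF => /exists_inPn vF.
  rewrite -(Fmax (v |: F0)%SET) ?finset.setU11 ?finset.subsetUr //.
  apply/andP; split; apply/forall_inP => u.
    rewrite !inE => /predU1P[->|uF]; apply/forall_inP => u'; rewrite !inE.
      by case/predU1P=> [->|/vF]; rewrite ?adj_irrefl.
    by case/predU1P=> [->|]; [rewrite adj_sym vF|apply: ind0].
  by rewrite !inE => /predU1P[->|/Fyz]; rewrite ?vy.
have nF0 v : adj v y || adj v z -> v \notin F0.
  by move=> H; apply: contraTN H => /Fyz; rewrite negb_or.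
have [yF wF xF zF] : [/\ y \notin F0, w \notin F0, x \notin F0 & z \notin F0].
  by split; apply: nF0; rewrite ?xy ?yz ?(adj_sym w) ?zw ?(adj_sym z) ?yz ?orbT.
pose F := (y |: (w |: F0))%SET.
have indF' : independent F.
  have yw' : ~~ adj y w.
    by rewrite adj_sym; apply/negP => /w_leaf E; rewrite E adj_irrefl in yz.
  have wf f : f \in F0 -> ~~ adj w f.
    by move=> fF; apply/negP => /w_leaf E; rewrite -E fF in zF.
  have yf f : f \in F0 -> ~~ adj y f.
    by move=> /Fyz/andP[]; rewrite adj_sym.
  have symN a b : ~~ adj a b -> ~~ adj b a by rewrite adj_sym.
  move=> u v; rewrite !inE => /or3P[/eqP->|/eqP->|uF] /or3P[/eqP->|/eqP->|vF].
  - by rewrite adj_irrefl.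
  - by [].
  - exact: yf.
  - exact: symN.
  - by rewrite adj_irrefl.
  - exact: wf.
  - exact/symN/yf.
  - exact/symN/wf.
  exact: ind0.
have cF : #|F| = (#|F0| + 2)%N.
  by rewrite /F !cardsU1 !inE negb_or yF wF yw /= addn2.
pose ts := [seq enum_rank v | v <- enum F0].
pose s := [seq enum_rank v | v <- enum (~: F0)%SET].
have mem_s v : (enum_rank v \in s) = (v \notin F0).
  by rewrite mem_map ?mem_enum ?inE //; apply: enum_rank_inj.
have mem_ts v : (enum_rank v \in ts) = (v \in F0).
  by rewrite mem_map ?mem_enum ?inE //; apply: enum_rank_inj.
have us : uniq (ts ++ s).
  rewrite cat_uniq !map_inj_uniq ?enum_uniq /= ?andbT; try exact: enum_rank_inj.
  apply/hasPn => i; rewrite -[i]enum_valK mem_s mem_ts; exact.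
(* The shifted degree [size ts + 2] equals [#|F|], the last one where vanishing is known; dropping
   the variables of [F0] leaves shifted degree 2, that of 1-forms. *)
have /koszul_exact_drop_vars : koszul_exact (size ts + 2)
    [seq ('X_i : S) | i <- ts ++ s]
    (mono_in (@edge_sq_dvd G)).
  apply: (cohen_macaulay_koszul_exact indF') => //; last first.
    by rewrite cF size_map -cardE.
  by move=> i; rewrite mem_cat -[i]enum_valK mem_s mem_ts orbN.
move=> /(_ (@edge_sq_dvd_upset G) us) H.
pose mu : mnm := (U y + U z + set_mnm F0)%MM.
(* [w] satisfies [inY] and [x] does not, so the two leaves will impose incompatible conditions on a
   primitive. *)
pose inY v := adj v z && ~~ adj v y.
pose al i : S := if inY (enum_val i) then 'X_i * 'X_[mu] else 0.
have idJ := mono_in_ideal K (@edge_sq_dvd_upset G).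
have XJ m : edge_sq_dvd m -> mono_in (@edge_sq_dvd G) ('X_[m] : S).
  by move=> dm m'; rewrite mcoeffX; case: (m =P m') => [<-|]; rewrite ?eqxx.
have leq_v_v' a b c d e : (a + b + (c + d) <= a + (c + (b + d + e)))%N.
  by clear; lia.
have leq_v_f a b c d e f : (b <= f)%N ->
    (a + b + (c + d) <= a + (e + (c + d + f)))%N.
  by clear; lia.
(* Two edges divide the product: [v]-[y] and [v']-[z] if [v] is adjacent to [y]; otherwise [y]-[z]
   and an edge from [v] to [F0] given by [dom]. *)
have killY v v' : v \notin F0 -> ~~ inY v -> inY v' ->
    mono_in (@edge_sq_dvd G)
      ('X_(enum_rank v) * ('X_(enum_rank v') * 'X_[mu]) : S).
  move=> vF nYv /andP[v'z v'y]; rewrite -!mpolyXD; apply: XJ.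
  have [vy|vy] := boolP (adj v y).
    exists v, y, v', z; split=> //; apply/mnm_lepP => i.
    by rewrite /mu !mnmDE; apply: leq_v_v'.
  have vz : ~~ adj v z by apply: contraNN nYv => vz; apply/andP.
  have [f fF vf] := dom _ vF vy vz.
  exists v, f, y, z; split=> //; apply/mnm_lepP => i.
  have : (U f i <= set_mnm F0 i)%N.
    by rewrite /set_mnm mnm_sumE (bigD1 f) //= leq_addr.
  by rewrite /mu !mnmDE; apply: leq_v_f.
have [|r Hr] := koszul_exact_family (f := al) idJ H.
  move=> i j; rewrite -[i]enum_valK -[j]enum_valK !mem_s.
  set v := enum_val i; set v' := enum_val j => vF v'F.
  rewrite /al !enum_rankK; have [Yv|Yv] := boolP (inY v);
    have [Yv'|Yv'] := boolP (inY v').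
  - by rewrite mulrCA subrr; case: idJ.
  - rewrite mulr0 add0r -[- _]addr0 -mulN1r; apply: idJ.2; last exact: idJ.1.
    exact: killY.
  - by rewrite mulr0 subr0; apply: killY.
  by rewrite !mulr0 subrr; apply: idJ.1.
(* At [x] the cocycle is 0, so x r lies in I(G)^2; since x u does not, the monomial u cannot occur
   in [r]. *)
have coef0 : r@_mu = 0.
  apply/eqP; apply/negP => /negP rmu.
  apply: (leaf_not_edge_sq_dvd yz x_leaf ind0 Fyz xy xz).
  have := Hr (enum_rank x); rewrite mem_s => /(_ xF); apply.
  rewrite /al /inY enum_rankK xy andbF sub0r mcoeffN oppr_eq0 mcoeffXM.
  by rewrite lem_addr addmC addmK.
have wz : adj w z by rewrite adj_sym.
have wy : ~~ adj w y.
  by apply/negP => /w_leaf E; rewrite E adj_irrefl in yz.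
(* The same lemma read from the other end of the path. By [coef0], w u has coefficient 1 in the
   element that [Hr] puts in I(G)^2 at [w]. *)
apply: (@leaf_not_edge_sq_dvd w z y F0) => //.
- by rewrite adj_sym.
- by move=> f /Fyz; rewrite andbC.
- by rewrite eq_sym.
rewrite [(U z + U y)%MM]addmC.
have := Hr (enum_rank w); rewrite mem_s => /(_ wF); apply.
rewrite /al /inY enum_rankK wz wy mcoeffB -mpolyXD mcoeffX eqxx mcoeffXM.
by rewrite lem_addr addmC addmK coef0 subr0 oner_eq0.
Qed.

End Whiskers.

Theorem theorem3p4 (K : fieldType) (G : sgraph) (p : 'I_4 -> G)
  (G_conn : connected_graph G)
  (p_path : induced_path4 p)
  (p_leaves : exists i j : 'I_4, [/\ i != j, leaf (p i) & leaf (p j)]) :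
  ~ cohen_macaulay_ideal (edge_ideal_sq K G).
Proof.
have [p_inj p_adj] := p_path.
pose o k (lt : (k < 4)%N) := Ordinal lt.
pose i0 := @o 0 isT; pose i1 := @o 1 isT.
pose i2 := @o 2 isT; pose i3 := @o 3 isT.
have a01 : adj (p i0) (p i1) by rewrite -edges_pair p_adj.
have a12 : adj (p i1) (p i2) by rewrite -edges_pair p_adj.
have a23 : adj (p i2) (p i3) by rewrite -edges_pair p_adj.
(* An inner vertex has two distinct neighbours on the path, so the two leaves must be its ends. *)
have n1 : ~~ leaf (p i1).
  apply/negP => /leaf_adj_uniq/(_ a12); rewrite adj_sym in a01.
  by move=> /(_ _ a01)/p_inj.
have n2 : ~~ leaf (p i2).
  apply/negP => /leaf_adj_uniq/(_ a23); rewrite adj_sym in a12.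
  by move=> /(_ _ a12)/p_inj.
have end_leaf i : leaf (p i) -> i = i0 \/ i = i3.
  case: i => [[|[|[|[|//]]]] lt] li; [left|exfalso|exfalso|right];
    try exact: val_inj.
    by case/negP: n1; congr (is_true (leaf (p _))): li; apply: val_inj.
  by case/negP: n2; congr (is_true (leaf (p _))): li; apply: val_inj.
have [l0 l3] : leaf (p i0) /\ leaf (p i3).
  have [i [j [ij li lj]]] := p_leaves.
  have [iE|iE] := end_leaf i li; have [jE|jE] := end_leaf j lj;
    by move: ij li lj; rewrite iE jE ?eqxx.
apply: (whiskers_not_cohen_macaulay a01 a12 a23).
- by apply/eqP => /p_inj.
- by apply/eqP => /p_inj.
- by move=> v /(leaf_adj_uniq l0); apply.
- by move=> v /(leaf_adj_uniq l3); rewrite adj_sym in a23; apply.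
Qed.
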